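(* Let $X$ be a second countable topological $T_1$-space, and let $\mu$ be the completion of a regular Borel $\sigma$-finite measure on $X$ vanishing on points. Let $\mathcal A$ be the $\sigma$-algebra of $\mu$-measurable sets and $\mathcal J$ the $\sigma$-ideal of $\mu$-zero sets. Then every infinite subset $E$ of $X$ can be decomposed into the union of an infinite family of pairwise disjoint subsets, each of which is a $\mathcal J$-full subset of $E$ (equivalently, each of which is completely non-measurable in $E$). In particular, each of these subsets has the same outer measure $\mu^*$ as $E$.
   Context: Measures are positive and countably additive. $\mu^*$ denotes the outer measure of $\mu$. For $E\subset Q\subset X$, $E$ is a $\mathcal J$-full subset of $Q$ if for each $B\in\mathcal A$ with $E\subset B$ one has $Q\smallsetminus B\in\mathcal J$. A subset $E\subset Q$ is completely non-measurable in $Q$ if for each $A\in\mathcal A$ with $A\cap Q\notin\mathcal J$ one has $A\cap E\notin\mathcal J$ and $A\cap(Q\smallsetminus E)\notin\mathcal J$. *)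

(* Defs.v *)
From HB Require Import structures.
From mathcomp Require Import all_boot all_order all_algebra.
From mathcomp Require Import all_classical all_reals all_analysis.
From mathcomp Require Import measurable_realfun.

Set Implicit Arguments.
Unset Strict Implicit.
Unset Printing Implicit Defensive.
Import Order.TTheory.

Local Open Scope classical_set_scope.
Local Open Scope ring_scope.
Local Open Scope ereal_scope.

Notation borel X := (g_sigma_algebraType (@open X)).

(* Inner regularity is with respect to closed sets because a compact subset of a
   T1 space need not be a Borel set. *)
Definition regular_measure (R : realType) (X : ptopologicalType)
    (nu : set (borel X) -> \bar R) : Prop :=
  forall B : set X, measurable (B : set (borel X)) ->
    nu B = ereal_inf [set nu U | U in [set U : set X | open U /\ B `<=` U]] /\
    nu B = ereal_sup [set nu F | F in [set F : set X | closed F /\ F `<=` B]].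

(* [completed_algebra_gen nu] consists of the sets [B `|` N] with [B] measurable
   and [N] contained in a measurable set of measure zero; it is already a
   sigma-algebra. *)
Notation completed_type nu := (g_sigma_algebraType (completed_algebra_gen nu)).

Definition is_completion (R : realType) (d : measure_display)
    (T : measurableType d) (nu : {measure set T -> \bar R})
    (mu : {measure set (completed_type nu) -> \bar R}) : Prop :=
  forall B N : set T, measurable B -> nu.-negligible N -> mu (B `|` N) = nu B.

Section completion_exists.
Context (R : realType) (d : measure_display) (T : measurableType d).
Context (nu : {measure set T -> \bar R}).
Local Notation U := (completed_type nu).

Lemma negligible_mu_ext (N : set T) : nu.-negligible N -> mu_ext nu N = 0.
Proof.
move=> [A [mA A0 NA]]; apply/eqP; rewrite eq_le outer_measure_ge0 andbT.
by rewrite -A0 -(measurable_mu_extE nu mA); exact: le_outer_measure.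
Qed.

Lemma completed_caratheodory (A : set U) : measurable A ->
  (mu_ext nu).-cara.-measurable (A : set (caratheodory_type (mu_ext nu))).
Proof.
move: A; apply: smallest_sub.
  split; first exact: measurable0.
    by move=> A mA; rewrite setTD; exact: measurableC.
  by move=> F mF; exact: bigcup_measurable.
move=> _ [B mB] [N nN] <-; apply: measurableU.
  by apply: sub_caratheodory; exact: sub_sigma_algebra.
apply: (@measure_is_complete_caratheodory _ _ (mu_ext nu)).
have [A [mA A0 NA]] := nN.
exists A; split; [|apply: negligible_mu_ext|exact: NA]; last first.
  by exists A; split; [exact: mA|exact: A0|exact: subset_refl].
by apply: sub_caratheodory; exact: sub_sigma_algebra.
Qed.

Definition completion_measure : set U -> \bar R := mu_ext nu.
Let completion_measure0 : completion_measure set0 = 0. Proof. exact: outer_measure0. Qed.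
Let completion_measure_ge0 A : 0 <= completion_measure A. Proof. exact: outer_measure_ge0. Qed.
Let completion_measure_sigma_additive : semi_sigma_additive completion_measure.
Proof.
move=> F mF tF mUF.
apply: (@caratheodory_measure_sigma_additive _ _ (mu_ext nu) F) => //.
  by move=> i; exact: completed_caratheodory.
exact: completed_caratheodory.
Qed.
HB.instance Definition _ := isMeasure.Build _ _ _ completion_measure
  completion_measure0 completion_measure_ge0 completion_measure_sigma_additive.

Lemma completion_exists :
  exists mu : {measure set U -> \bar R}, is_completion mu.
Proof.
exists completion_measure => B N mB nN.
rewrite /completion_measure/=; rewrite -(measurable_mu_extE nu mB).
apply/eqP; rewrite eq_le; apply/andP; split; last first.
  by apply: le_outer_measure; exact: subsetUl.
by apply: (le_trans (outer_measureU2 (mu_ext nu) _ _)); rewrite [X in _ + X](negligible_mu_ext nN) adde0.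
Qed.
End completion_exists.

Definition null_sets (R : realType) (d : measure_display)
    (T : measurableType d) (mu : set T -> \bar R) : set (set T) :=
  [set N | measurable N /\ mu N = 0].

Definition full_subset (T : Type) (A J : set (set T)) (Q E : set T) : Prop :=
  E `<=` Q /\ forall B, A B -> E `<=` B -> J (Q `\` B).

Definition completely_nonmeasurable (T : Type) (A J : set (set T))
    (Q E : set T) : Prop :=
  E `<=` Q /\
  forall B, A B -> ~ J (B `&` Q) -> ~ J (B `&` E) /\ ~ J (B `&` (Q `\` E)).

Definition infinite_decomposition (T : Type) (E : set T) (D : set (set T)) :
    Prop :=
  [/\ infinite_set D, trivIset D id & \bigcup_(F in D) F = E].

(* Main.v *)
Require Import Defs.
From HB Require Import structures.
From mathcomp Require Import all_boot all_order all_algebra.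
From mathcomp Require Import all_classical all_reals all_analysis.
From mathcomp Require Import measurable_realfun.

Set Implicit Arguments.
Unset Strict Implicit.
Unset Printing Implicit Defensive.
Import Order.TTheory GRing.Theory Num.Theory.

Local Open Scope classical_set_scope.
Local Open Scope ring_scope.
Local Open Scope ereal_scope.

(** A set [P] is thick in a measurable set [M] if it meets every non-null
    measurable part of [M] in a non-negligible set. The core is a theorem of
    Lusin: every non-negligible [E] contains [P] such that [P] and [E \ P] are
    both thick in some [M] of positive measure. Were it false, all subsets of
    [E] would be measurable relatively to [E] modulo null sets, and second
    countability and outer regularity would make an order on a subset of [E]
    whose initial segments are negligible measurable in the plane, contradicting
    Fubini. By exhaustion (sigma-finiteness), every set splits into two full
    subsets; splitting one half again and again gives infinitely many disjoint
    full subsets. A negligible set is decomposed into its points. *)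

(** * Thick sets and splittings over a sigma-finite measure *)

Section thick_sets.
Context (R : realType) (d : measure_display) (T : measurableType d).
Context (nu : {measure set T -> \bar R}) (nu_sf : sigma_finite [set: T] nu).

(** On each piece [F n] of finite measure, members of [G] approach the supremum of [nu (B]&[F n)].
    Their union [M] attains all these suprema at once, so joining [C] to [M] gains nothing on [F n],
    and finiteness allows cancellation. *)
Lemma exhaustion (G : set (set T)) : G `<=` measurable -> G set0 ->
  (forall F : (set T)^nat, (forall i, G (F i)) -> G (\bigcup_i F i)) ->
  exists2 M, G M & forall B, G B -> nu (B `\` M) = 0.
Proof.
move=> Gm G0 GU; have [F TF mF] := nu_sf.
pose S n := [set nu (B `&` F n) | B in G].
have SN0 n : S n != set0 by apply/set0P; exists (nu (set0 `&` F n)); exists set0.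
have /choice[B BP] : forall n, exists B : (set T)^nat, (forall i, G (B i)) /\
    nu (B i `&` F n) @[i --> \oo] --> ereal_sup (S n).
  move=> n; have [u Su ucvg] := ereal_sup_seq (SN0 n).
  have /choice[B BP] : forall i, exists B, G B /\ nu (B `&` F n) = u i.
    by move=> i; have [B ? ?] := Su i; exists B.
  exists B; split => [i|]; first by have [] := BP i.
  by under eq_fun do rewrite (BP _).2.
have GB n i : G (B n i) by exact: (BP n).1.
pose M := \bigcup_n \bigcup_i B n i.
have GM : G M by apply: (GU) => n; exact: GU.
have supM n : ereal_sup (S n) <= nu (M `&` F n).
  have cB := (BP n).2.
  rewrite -(cvg_lim _ cB)//; apply: lime_le.
    by apply/cvg_ex; eexists; exact: cB.
  apply: nearW => i; apply: le_measure; rewrite ?inE.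
  - by apply: measurableI; [exact/Gm/GB|exact: (mF n).1].
  - by apply: measurableI; [exact/Gm|exact: (mF n).1].
  - by apply: setSI => x Bx; exists n => //; exists i.
exists M => // C GC.
have mC := Gm _ GC; have mM := Gm _ GM.
have GCM : G (M `|` C).
  have -> : M `|` C = \bigcup_i (if i is 0%N then M else C).
    apply/seteqP; split => [x [Mx|Cx]|x [[|i] _ Bx]]; [| |by left|by right].
    - by exists 0%N.
    - by exists 1%N.
  by apply: GU => -[].
apply/negligibleP; first exact: measurableD.
rewrite -(setIT (C `\` M)) TF setI_bigcupr.
apply: negligible_bigcup => n.
have [mFn Fnoo] := mF n.
have mCMF : measurable ((C `\` M) `&` F n).
  by apply: measurableI mFn; exact: measurableD mM.
have mMF : measurable (M `&` F n) by exact: measurableI.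
apply/negligibleP => //.
have MFfin : nu (M `&` F n) \is a fin_num.
  rewrite ge0_fin_numE//; apply: le_lt_trans Fnoo.
  by apply: le_measure; rewrite ?inE//; exact: subIsetr.
have : nu (M `&` F n) + nu ((C `\` M) `&` F n) <= nu (M `&` F n).
  rewrite -measureU//.
    apply: le_trans (supM n); apply: ereal_sup_ubound; exists (M `|` C) => //.
    congr (nu _); rewrite -setIUl; congr (_ `&` _).
    apply/seteqP; split => x; last by move=> [Mx|[Cx _]]; [left|right].
    by have [Mx|nMx] := pselect (M x); [left|move=> [//|Cx]; right].
  by apply/seteqP; split=> // x [[Mx _] [[_ ]]].
by rewrite -[leRHS]adde0 leeD2lE// measure_le0 => /eqP.
Qed.

Definition thick (P M : set T) := forall B, measurable B -> B `<=` M ->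
  nu.-negligible (P `&` B) -> nu B = 0.

Lemma thickS P P' M M' : P `<=` P' -> M' `<=` M -> thick P M -> thick P' M'.
Proof.
move=> PP MM tP B mB BM nB; apply: tP => //; first exact: subset_trans MM.
by apply: negligibleS nB; exact: setSI.
Qed.

Lemma thick_bigcup (P : set T) (D : (set T)^nat) :
  (forall i, measurable (D i)) -> (forall i, thick (P `&` D i) (D i)) ->
  thick P (\bigcup_i D i).
Proof.
move=> mD tPD B mB BD nPB; apply/negligibleP => //.
rewrite -(setIidl BD) setI_bigcupr; apply: negligible_bigcup => i.
have mBD : measurable (B `&` D i) by exact: measurableI.
apply/negligibleP => //; apply: (tPD i) => //.
by apply: negligibleS nPB => x [[Px _] [Bx _]].
Qed.

(** [C] serves as a measurable hull of [P]: it is the complement of a largest measurable set, modulo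
    null sets, in which [P] is negligible. *)
Lemma thick_hull P :
  exists C, [/\ measurable C, thick P C & nu.-negligible (P `\` C)].
Proof.
pose G := [set B | measurable B /\ nu.-negligible (P `&` B)].
have [//|||M [mM nM] maxM] := @exhaustion G; first by move=> B [].
- by split => //; rewrite setI0; exact: negligible_set0.
- move=> F GF; split; first by apply: bigcupT_measurable => i; case: (GF i).
  by rewrite setI_bigcupr; apply: negligible_bigcup => i; case: (GF i).
exists (~` M); split; first exact: measurableC.
- move=> B mB BM nB; rewrite -(maxM B)//; congr (nu _).
  by apply/esym/setDidl/disjoints_subset.
- by rewrite setDE setCK.
Qed.

Definition splits (E M : set T) :=
  exists2 P, P `<=` E & thick P M /\ thick (E `\` P) M.

Lemma splits_bigcup E (M : (set T)^nat) : (forall i, measurable (M i)) ->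
  (forall i, splits E (M i)) -> splits E (\bigcup_i M i).
Proof.
move=> mM sM; have /choice[P PP] : forall i, exists P,
    [/\ P `<=` E, thick P (M i) & thick (E `\` P) (M i)].
  by move=> i; have [P ? []] := sM i; exists P.
pose D := seqDU M.
have tD : trivIset setT D by exact: trivIset_seqDU.
have mD i : measurable (D i).
  by apply: measurableD => //; apply: bigsetU_measurable.
have DM i : D i `<=` M i by exact: subDsetl.
have thD Q i : thick Q (M i) -> thick (Q `&` D i) (D i).
  move=> tQ B mB BD nB; apply: tQ => //; first exact: subset_trans (DM i).
  by apply: negligibleS nB => x [Qx Bx]; do 2?split => //; exact: BD.
have uD i j x : D i x -> D j x -> i = j.
  by move=> Dix Djx; apply: tD => //; exists x.
exists (\bigcup_i (P i `&` D i)); first by move=> x [i _ [Px _]]; case: (PP i) => + _ _; exact.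
have DU : \bigcup_i M i = \bigcup_i D i by exact: seqDU_bigcup_eq.
rewrite DU; split; apply: thick_bigcup => // i; have [_ tP tEP] := PP i.
  apply: thickS (thD _ _ tP) => // x [Px Dx]; split => //.
  by exists i.
apply: thickS (thD _ _ tEP) => // x [[Ex Px] Dx]; split => //; split => //.
by move=> [j _ [Pjx /(uD _ _ _ Dx) ij]]; apply: Px; rewrite ij.
Qed.

Lemma splitsS E E' M : E' `<=` E -> splits E' M -> splits E M.
Proof.
move=> EE [P PE [tP tEP]]; exists P; first exact: subset_trans EE.
by split => //; apply: thickS tEP => //; exact: setSD.
Qed.

(** Take hulls [C] of [P] and [C'] of [E]\[P]. Both parts are thick in [C]&[C'], so [E] splits there
    and this intersection is null. Hence [P] is the trace of [C] on [E] modulo a negligible set. *)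
Lemma nonsplitting_trace E :
  (forall M, measurable M -> splits E M -> nu M = 0) ->
  forall P, P `<=` E -> exists C, [/\ measurable C, nu.-negligible (P `\` C) &
    nu.-negligible ((E `\` P) `&` C)].
Proof.
move=> nsE P PE.
have [C [mC tC nC]] := thick_hull P.
have [C' [mC' tC' nC']] := thick_hull (E `\` P).
exists C; split => //.
have mCC : measurable (C `&` C') by exact: measurableI.
have CC0 : nu (C `&` C') = 0.
  by apply: nsE => //; exists P => //; split;
    [apply: thickS tC|apply: thickS tC'] => // x [].
apply: (@negligibleS _ _ _ nu ((E `\` P) `\` C' `|` (C `&` C'))).
  by move=> x [EPx Cx]; have [?|?] := pselect (C' x); [right|left].
by apply: negligibleU => //; exact/negligibleP.
Qed.

(** Let [M] be largest, modulo null sets, among the sets on which [E] splits. If [E]\[M] were not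
    negligible, it would split on a non-null [N]; but [N]\[M] is null by maximality, and [N]&[M] is
    null because subsets of [E]\[M] miss it. *)
Lemma splitting_exhaustion E :
  (forall E', E' `<=` E -> ~ nu.-negligible E' ->
     exists M, [/\ measurable M, splits E' M & nu M <> 0]) ->
  exists M, [/\ measurable M, splits E M & nu.-negligible (E `\` M)].
Proof.
move=> locE; pose G := [set M | measurable M /\ splits E M].
have [//|||M [mM sM] maxM] := @exhaustion G; first by move=> B [].
- split => //; exists set0 => //.
  by split=> B mB; rewrite subset0 => ->; rewrite measure0.
- move=> F GF; split; first by apply: bigcupT_measurable => i; case: (GF i).
  by apply: splits_bigcup => i; case: (GF i).
exists M; split => //; apply: contrapT => nEM.
have [//|N [mN sN N0]] := locE _ _ nEM.
have [P PEM [tP _]] := sN.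
apply: N0; apply: measure_negligible => //.
rewrite -(setDUK (A := N `&` M) (B := N)) ?setDIr ?setDv ?set0U//.
apply: negligibleU; last first.
  apply/negligibleP; first exact: measurableD.
  by apply: maxM; split => //; apply: splitsS sN.
have mNM : measurable (N `&` M) by exact: measurableI.
apply/negligibleP => //; apply: tP => //.
apply: negligibleS (negligible_set0 nu) => x [/PEM[_ nMx]] [_ /nMx].
by [].
Qed.

(* [E'] is the union of a maximal chain of negligible subsets of [E], and
   [r x y] says that every member of the chain containing [x] contains [y]. *)
Lemma negligible_chain E : (forall x, nu.-negligible [set x]) ->
  ~ nu.-negligible E -> exists E' (r : T -> T -> Prop),
  [/\ E' `<=` E, ~ nu.-negligible E',
      forall x, E' x -> nu.-negligible [set y | E' y /\ r x y] &
      forall y, E' y -> nu.-negligible [set x | E' x /\ ~ r x y]].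
Proof.
move=> nx nE.
pose Ch := [set c : set (set T) | total_on c subset /\
  forall A, c A -> A `<=` E /\ nu.-negligible A].
have [F FCh totF|c [[totc cE] maxc]] := @Zorn_bigcup _ Ch.
  split=> [A B [c Fc cA] [c' Fc' cB]|A [c Fc cA]]; last first.
    by have [_ ] := FCh _ Fc; exact.
  have [cc|cc] := totF _ _ Fc Fc'.
  - by have [tot _] := FCh _ Fc'; apply: tot => //; exact: cc.
  - by have [tot _] := FCh _ Fc; apply: tot => //; exact: cc.
pose E' := \bigcup_(A in c) A.
have E'E : E' `<=` E by move=> x [A /cE[AE _] /AE].
exists E', (fun x y => forall A, c A -> A x -> A y); split => //.
(* If the union were negligible, adjoining to it a point of [E] outside it would give a longer
   chain. *)
- move=> nE'.
  have [x [Ex E'x]] : exists x, E x /\ ~ E' x.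
    apply: contrapT => noEx; apply: nE; apply: negligibleS nE' => x Ex.
    by apply: contrapT => E'x; apply: noEx; exists x.
  pose A := E' `|` [set x].
  have cA : ~ c A by move=> cA; apply: E'x; exists A => //; right.
  apply: (maxc (c `|` [set A])).
    split; first exact: subsetUl.
    by move=> /(_ A) h; apply: cA; apply: h; right.
  have cA' B : c B -> B `<=` A by move=> cB y By; left; exists B.
  split=> [B B' [cB|->] [cB'|->]|B [cB|->]].
  - exact: totc.
  - by left; exact: cA'.
  - by right; exact: cA'.
  - by left.
  - exact: cE.
  - split; last exact: negligibleU.
    by move=> y [/E'E//|->].
- move=> x [A cA Ax]; have [_ nA] := cE _ cA.
  by apply: negligibleS nA => y [_]; exact.
(* A point outside [A] satisfies [r x y]: a member of the chain containing [x] is not included in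
   [A], so it includes [A] and contains [y]. *)
- move=> y [A cA Ay]; have [_ nA] := cE _ cA.
  apply: negligibleS nA => x [_ nr]; apply: contrapT => nAx; apply: nr => B cB Bx.
  have [AB|BA] := totc _ _ cA cB; first exact: AB.
  by case: nAx; exact: BA.
Qed.

End thick_sets.

(** * Fubini for sets with null sections *)

Section negligible_ysections.
Context (R : realType) (d : measure_display) (T : measurableType d).
Context (mu : {measure set T -> \bar R}) (mu_sf : sigma_finite [set: T] mu).

(* A copy of [mu] that carries the canonical structure of a sigma-finite measure. *)
Let nu : set T -> \bar R := mu.

HB.instance Definition _ := Measure.on nu.
HB.instance Definition _ := Measure_isSigmaFinite.Build _ _ _ nu mu_sf.

Lemma negligible_ysections (K : set (T * T)) (S : set T) : measurable K ->
  (forall x, S x -> mu (xsection K x) = 0) ->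
  mu.-negligible [set y | ~ mu.-negligible (S `&` ysection K y)].
Proof.
rewrite -[mu : set T -> \bar R]/nu => mK SK.
have mf := @measurable_fun_xsection _ _ _ _ _ nu K mK.
(* [S] may be non-measurable. It is replaced by the measurable set [Bh] of all points with null
   vertical section; the part of [K] over [Bh] is null in the plane, so almost all of its horizontal
   sections are null. *)
pose Bh := [set x | nu (xsection K x) = 0].
have mBh : measurable Bh.
  rewrite (_ : Bh = setT `&` (nu \o xsection K) @^-1` [set 0]); last first.
    by rewrite setTI.
  exact: mf.
pose K' := K `&` (Bh `*` setT).
have mK' : measurable K' by apply: measurableI => //; exact: measurableX.
have int0 : (nu \x nu)%E K' = 0.
  rewrite /product_measure1 integral0_eq// => x _ /=.
  have [Bx|Bx] := pselect (Bh x).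
    rewrite -[RHS]Bx; congr (nu _); apply/seteqP; split => y.
      by rewrite /xsection/= !inE => -[].
    by rewrite /xsection/= !inE => Ky; split.
  rewrite (_ : xsection K' x = set0) ?measure0//.
  by apply/seteqP; split => y //; rewrite /xsection/= inE => -[_ []].
have int0' : (nu \x^ nu)%E K' = 0.
  rewrite -int0; apply/esym; apply: product_measure_unique => //= A B mA mB.
  by rewrite product_measure2E.
have mg := @measurable_fun_ysection _ _ _ _ _ nu K' mK'.
have : \int[nu]_y `|(nu \o ysection K') y| = 0.
  by rewrite -[RHS]int0'; apply: eq_integral => y _; rewrite gee0_abs.
move=> /(ae_eq_integral_abs nu measurableT mg).
apply: negligibleS => y /= nSy h; apply: nSy.
have /negligibleP : nu (ysection K' y) = 0 by exact: h.
move=> /(_ (measurable_ysection _ mK')); apply: negligibleS => x [Sx].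
by rewrite /ysection/= !inE => Kxy; split => //; split => //; exact: SK.
Qed.

End negligible_ysections.

(** * Local splitting in second countable spaces *)

Section second_countable_measure.
Context (R : realType) (X : ptopologicalType).
Context (nu : {measure set (borel X) -> \bar R}).

Lemma open_borel (U : set X) : open U -> measurable (U : set (borel X)).
Proof. by move=> oU; exact: sub_sigma_algebra. Qed.

Lemma second_countable_seq : @second_countable X ->
  exists Bs : (set X)^nat, (forall k, open (Bs k)) /\
    forall U x, open U -> U x -> exists k, Bs k x /\ Bs k `<=` U.
Proof.
move=> [B cB [Bo Bx]].
have /pfcard_geP[B0|/unsquash Bs] := cB.
  have [V []] := Bx point setT filterT; rewrite B0.
  by [].
exists Bs; split => [k|U x oU Ux]; first by apply: Bo; exact: funS.
have [V [BV Vx] VU] : filter_from [set U | B U /\ U x] id U.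
  by apply: Bx; exact: open_nbhs_nbhs.
by have [k _ kV] := surj (f := Bs) BV; exists k; rewrite kV.
Qed.

Lemma negligible_open_cover (N : set X) (e : R) : regular_measure nu ->
  (0 < e)%R -> nu.-negligible (N : set (borel X)) ->
  exists U : set X, [/\ open U, N `<=` U & nu U < e%:E].
Proof.
move=> reg e0 [Z [mZ Z0 NZ]].
have [ZE _] := reg _ mZ.
rewrite -lte_fin in e0.
have /ereal_inf_lt[_ [U [oU ZU] <-] Ue] :
    ereal_inf [set nu U | U in [set U : set X | open U /\ Z `<=` U]] < e%:E.
  by rewrite -ZE Z0.
by exists U; split => //; exact: subset_trans ZU.
Qed.

(* Lusin's argument. If no piece splits, every subset of [E'] is, up to a
   negligible set, the trace of a Borel set. Cover each [W_x = {y | r x y}] by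
   open sets of small measure: recording which basic open sets are used
   encloses [r] in a Borel set [K] of the plane with null vertical sections,
   whereas almost all of [E'] lies in each horizontal section over [E']. *)
Lemma locally_splits (E : set X) : @second_countable X ->
  regular_measure nu -> sigma_finite [set: borel X] nu ->
  (forall x : X, nu.-negligible ([set x] : set (borel X))) ->
  ~ nu.-negligible (E : set (borel X)) ->
  exists M : set (borel X), [/\ measurable M, splits nu E M & nu M <> 0].
Proof.
move=> scX reg sf nx nE; apply: contrapT => noM.
have [E' [r [E'E nE' rx ry]]] :=
  @negligible_chain _ _ (borel X) nu E nx nE.
have nsE' (M : set (borel X)) : measurable M -> splits nu E' M -> nu M = 0.
  move=> mM sM; apply: contrapT => M0; apply: noM; exists M; split => //.
  exact: splitsS sM.
have [Bs [oBs BsP]] := second_countable_seq scX.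
have /choice[U UP] : forall xn : X * nat, exists U : set X, E' xn.1 ->
    [/\ open U, [set y | E' y /\ r xn.1 y] `<=` U & nu U < (xn.2.+1%:R^-1)%:E].
  move=> [x n]; have [E'x|nE'x] := pselect (E' x); last by exists set0.
  have [|U UP] := @negligible_open_cover _ n.+1%:R^-1 reg _ (rx _ E'x).
    by rewrite invr_gt0.
  by exists U.
(* Since [U (x, n)] is open, it is the union of those [Bs k] for which [x] lies in [P (n, k)]. *)
pose P (nk : nat * nat) : set X := [set x | E' x /\ Bs nk.2 `<=` U (x, nk.1)].
have /choice[C CP] : forall nk, exists C : set (borel X),
    [/\ measurable C, nu.-negligible (P nk `\` C : set (borel X)) &
        nu.-negligible ((E' `\` P nk) `&` C : set (borel X))].
  by move=> nk; apply: (nonsplitting_trace sf nsE') => x [].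
pose Z : set (borel X) := \bigcup_n \bigcup_k
  ((P (n, k) `\` C (n, k)) `|` ((E' `\` P (n, k)) `&` C (n, k))).
have nZ : nu.-negligible Z.
  apply: negligible_bigcup => n; apply: negligible_bigcup => k.
  by case: (CP (n, k)) => _ ? ?; exact: negligibleU.
(* For [x] in [E'] outside [Z], the vertical section of [K] is the intersection over [n] of the sets
   [U (x, n)], hence null. *)
pose K : set (borel X * borel X) :=
  \bigcap_n \bigcup_k (C (n, k) `*` (Bs k : set (borel X))).
have mK : measurable K.
  apply: bigcapT_measurable => n; apply: bigcupT_measurable => k.
  by apply: measurableX; [case: (CP (n, k))|exact: open_borel].
have CPE n k x : E' x -> ~ Z x -> C (n, k) x <-> P (n, k) x.
  move=> E'x nZx; split => [Cx|Px]; apply: contrapT => h; apply: nZx;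
    exists n => //; exists k => //; [right|left]; split => //.
have Kx x : (E' `\` Z) x -> nu (xsection K x) = 0.
  move=> [E'x nZx]; apply/eqP; rewrite -measure_le0; apply/lee_addgt0Pr => e e0.
  have [n ne] : exists n : nat, (n.+1%:R^-1 < e)%R.
    by have [n] := ltr_add_invr e0; rewrite add0r; exists n.
  have [oU _ Ue] := UP (x, n) E'x.
  rewrite -lte_fin in ne; rewrite add0e; apply: le_trans (ltW (lt_trans Ue ne)).
  apply: le_measure; rewrite ?inE; [exact: measurable_xsection|exact: open_borel|].
  move=> y; rewrite /xsection/= inE => /(_ n I)[k _ [Cx Oy]].
  by have [_] := (CPE n k x E'x nZx).1 Cx; exact.
have nY := negligible_ysections sf mK Kx.
have [y [E'y nYy]] :
    exists y, E' y /\ nu.-negligible ((E' `\` Z) `&` ysection K y).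
  apply: contrapT => noy; apply: nE'; apply: negligibleS nY => y E'y nYy.
  by apply: noy; exists y.
(* Each [x] in [E'] lies in [Z], or in the section of [K] at [y] when [r x y] holds, or in the
   negligible set where [r x y] fails; so [E'] would be negligible. *)
apply: nE'.
apply: negligibleS (negligibleU nZ (negligibleU nYy (ry _ E'y))) => x E'x.
have [Zx|nZx] := pselect (Z x); [by left|right].
have [rxy|nr] := pselect (r x y); [left|by right].
split => //; rewrite /ysection/= inE => n _.
have [oU rU _] := UP (x, n) E'x.
have [|k [Oy OU]] := BsP _ y oU; first exact: rU.
by exists k => //; split => //; apply/CPE.
Qed.

End second_countable_measure.

(** * Outer measure of full subsets, and decomposition into points *)

(** The union of a countable measurable cover of [F] misses only a null part of [E], so it bounds
    the outer measure of [E] at no extra cost. *)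
Lemma mu_ext_full_subset (R : realType) (d : measure_display)
    (T : measurableType d) (mu : {measure set T -> \bar R}) (E F : set T) :
  full_subset measurable (null_sets mu) E F -> mu^*%mu F = mu^*%mu E.
Proof.
move=> [FE fF]; apply/eqP; rewrite eq_le le_outer_measure//=.
apply: le_ereal_inf_tmp => _ [A [mA FA] <-].
have mUA : measurable (\bigcup_i A i) by exact: bigcupT_measurable.
have [mEA EA0] := fF _ mUA FA.
apply: (@le_trans _ _ (mu^*%mu (\bigcup_i A i `|` (E `\` \bigcup_i A i)))).
  apply: le_outer_measure => x Ex.
  by have [?|?] := pselect ((\bigcup_i A i) x); [left|right].
apply: (le_trans (outer_measureU2 (mu_ext mu) _ _)).
rewrite [X in _ + X](_ : _ = 0) ?adde0; last first.
  by rewrite -EA0; exact: measurable_mu_extE.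
apply: (le_trans (outer_measure_sigma_subadditive (mu_ext mu) A)).
rewrite (eq_eseriesr (g := fun i => mu (A i)))// => i _.
exact: measurable_mu_extE.
Qed.

Lemma singleton_decomposition (T : Type) (E : set T) : infinite_set E ->
  infinite_decomposition E [set [set x] | x in E].
Proof.
move=> Einf; split.
- move=> fD; apply: Einf.
  apply: sub_finite_set (finite_preimage _ fD) => [x Ex|]; first by exists x.
  by move=> x y _ _ /seteqP[/(_ x erefl)].
- move=> _ _ [x _ <-] [y _ <-] [z [/= -> ->]].
  by [].
- apply/seteqP; split => [_ [_ [x Ex <-] ->]//|x Ex].
  by exists [set x] => //; exists x.
Qed.

(** * Full subsets with respect to the completion *)

Section completion_ideal.
Context (R : realType) (d : measure_display) (T : measurableType d).
Context (nu : {measure set T -> \bar R}).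
Context (mu : {measure set (completed_type nu) -> \bar R}).
Hypothesis mu_completion : is_completion mu.

Let A : set (set T) := @measurable _ (completed_type nu).
Let J : set (set T) := null_sets mu.

Lemma completed_measurableE B : A B ->
  exists C N, [/\ measurable C, nu.-negligible N & B = C `|` N].
Proof.
pose S := [set B | exists C N, [/\ measurable C, nu.-negligible N & B = C `|` N]].
suff : A `<=` S by exact.
apply: smallest_sub; last first.
  by move=> _ [C mC [N nN <-]]; exists C, N.
split.
- exists set0, set0; split; rewrite ?setU0//; exact: negligible_set0.
- move=> _ [C [N [mC nN ->]]]; have [Z [mZ Z0 NZ]] := nN.
  (* [N] may be non-measurable, so the complement is cut along the measurable null set [Z]
     containing [N]. *)
  exists (~` C `\` Z), (~` C `&` Z `\` N); split.
  + by apply: measurableD => //; exact: measurableC.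
  + by exists Z; split => // x [[]].
  + rewrite setTD setCU; apply/seteqP; split => x.
      by move=> [nCx nNx]; have [Zx|nZx] := pselect (Z x); [right|left].
    by move=> [[nCx nZx]|[[nCx _] nNx]]; split => // /NZ.
- move=> F SF; have /choice[C CP] := SF; have /choice[N NP] := CP.
  exists (\bigcup_i C i), (\bigcup_i N i); split.
  + by apply: bigcupT_measurable => i; case: (NP i).
  + by apply: negligible_bigcup => i; case: (NP i).
  + by rewrite -bigcupU; apply: eq_bigcupr => i _; case: (NP i).
Qed.

Lemma null_sets_completionE N : J N <-> nu.-negligible N.
Proof.
split=> [[/completed_measurableE[C [M [mC nM ->]]]]|nN].
  by rewrite mu_completion// => C0; apply: negligibleU => //; exact/negligibleP.
have N0 : N = set0 `|` N by rewrite set0U.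
split; last by rewrite N0 mu_completion.
by apply: sub_sigma_algebra; exists set0 => //; exists N.
Qed.

(** A measurable [B] containing [F] misses a null part of [Q]; adding that part gives a measurable
    set containing [Q], to which fullness of [Q] in [E] applies. *)
Lemma full_subset_trans E Q F :
  full_subset A J E Q -> full_subset A J Q F -> full_subset A J E F.
Proof.
move=> [QE fQ] [FQ fF]; split; first exact: subset_trans QE.
move=> B AB FB; have QB := fF _ AB FB.
have AQB : A (B `|` (Q `\` B)).
  by apply: (@measurableU _ (completed_type nu)) => //; case: QB.
have JEQ : J (E `\` (B `|` (Q `\` B))).
  by apply: fQ => // x Qx; have [Bx|nBx] := pselect (B x); [left|right].
move: JEQ QB => /null_sets_completionE nEQ /null_sets_completionE nQB.
apply/null_sets_completionE; apply: negligibleS (negligibleU nEQ nQB).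
move=> x [Ex nBx]; have [Qx|nQx] := pselect (Q x); [by right|left].
by split => // -[//|[]].
Qed.

Lemma full_subsetS E F F' : F `<=` F' -> F' `<=` E ->
  full_subset A J E F -> full_subset A J E F'.
Proof.
by move=> FF FE [_ fF]; split => // B AB FB; apply: fF => //; exact: subset_trans FB.
Qed.

(** If [B], equal to [C] up to a negligible set, contains [P], then [P] is negligible in [M]\[C],
    which is therefore null by thickness. *)
Lemma thick_full_subset E P M : measurable M -> P `<=` E ->
  nu.-negligible (E `\` M) -> thick nu P M -> full_subset A J E P.
Proof.
move=> mM PE nEM tP; split => // B /completed_measurableE[C [N [mC nN ->]]] PB.
apply/null_sets_completionE.
have mMC : measurable (M `\` C) by exact: measurableD.
have MC0 : nu (M `\` C) = 0.
  apply: tP => //.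
  by apply: negligibleS nN => x [/PB[Cx|Nx] [_ nCx]].
apply: negligibleS (negligibleU nEM ((negligibleP nu mMC).2 MC0)).
move=> x [Ex nCNx]; have [Mx|nMx] := pselect (M x); [right|by left].
by split => // Cx; apply: nCNx; left.
Qed.

Lemma negligible_full_subset E F : nu.-negligible E -> F `<=` E ->
  full_subset A J E F.
Proof.
move=> nE FE; split => // B _ _; apply/null_sets_completionE.
by apply: negligibleS nE; exact: subDsetl.
Qed.

Lemma full_subset_nonmeasurable E (D : set (set T)) :
  infinite_decomposition E D ->
  (forall F, D F -> full_subset A J E F) <->
  (forall F, D F -> completely_nonmeasurable A J E F).
Proof.
move=> [Dinf Dtriv DE]; split=> [fD F DF|nD F DF]; last first.
  have [FE nF] := nD F DF; split => // B AB FB; apply: contrapT => JEB.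
  have AB' : A (~` B) by exact: (@measurableC _ (completed_type nu)).
  have [|+ _] := nF _ AB'; first by rewrite setIC -setDE.
  apply; apply/null_sets_completionE.
  by apply: negligibleS (negligible_set0 nu) => x [nBx /FB/nBx].
(* If [B]&[G] is null, then the complement of [B] together with [B]&[G] is measurable and contains
   [G], which forces [B]&[E] to be null. *)
have full_meets G B : D G -> A B -> ~ J (B `&` E) -> ~ J (B `&` G).
  move=> DG AB nJ JBG; have [GE fG] := fD G DG.
  have AB' : A (~` B `|` (B `&` G)).
    apply: (@measurableU _ (completed_type nu)); last by case: JBG.
    exact: (@measurableC _ (completed_type nu)).
  have JEB : J (E `\` (~` B `|` (B `&` G))).
    by apply: fG => // x Gx; have [Bx|nBx] := pselect (B x); [right|left].
  move: JEB JBG => /null_sets_completionE nEB /null_sets_completionE nBG.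
  apply: nJ; apply/null_sets_completionE; apply: negligibleS (negligibleU nEB nBG).
  move=> x [Bx Ex]; have [Gx|nGx] := pselect (G x); [by right|left].
  by split => // -[//|[_ /nGx]].
split; first by have [] := fD F DF.
move=> B AB nJ; split; first exact: full_meets.
(* A second member [G] of the family lies in [E]\[F], so that [full_meets] for [G] also handles the
   complement of [F]. *)
have [G [DG GF]] : exists G, D G /\ G <> F.
  apply: contrapT => noG; apply: Dinf; apply: sub_finite_set (finite_set1 F).
  by move=> G DG; apply: contrapT => GF; apply: noG; exists G.
move=> JBF; apply: (full_meets G B) => //.
have [GE _] := fD G DG.
apply/null_sets_completionE.
apply: negligibleS ((null_sets_completionE _).1 JBF) => x [Bx Gx].
split => //; split; first exact: GE.
by move=> Fx; apply: GF; apply: Dtriv => //; exists x.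
Qed.

(* The sets [F n] need not cover [E]; what they miss is added to [F 0]. *)
Lemma full_sequence_decomposition E (F : (set T)^nat) : ~ nu.-negligible E ->
  (forall n, full_subset A J E (F n)) -> trivIset setT F ->
  exists D : set (set T),
    infinite_decomposition E D /\ forall G, D G -> full_subset A J E G.
Proof.
move=> nE fF tF.
have FE n : F n `<=` E by have [] := fF n.
pose G n := if n is 0%N then E `\` \bigcup_k F k.+1 else F n.
have uF i j x : F i x -> F j x -> i = j.
  by move=> Fix Fjx; apply: tF => //; exists x.
have FG n : F n `<=` G n.
  case: n => [x F0x|n]; last exact: subset_refl.
  by split; [exact: FE F0x|move=> [k _ /uF/(_ F0x)]].
have GE n : G n `<=` E by case: n => [|n]; [exact: subDsetl|exact: FE].
have fG n : full_subset A J E (G n) by exact: full_subsetS (fF n).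
have uG i j x : G i x -> G j x -> i = j.
  case: i j => [|i] [|j]//=.
  - by move=> [_ nFx] Fx; case: nFx; exists j.
  - by move=> Fx [_ nFx]; case: nFx; exists i.
  - exact: uF.
(* The empty set is not full in a non-negligible [E]. With disjointness this makes [G] injective, so
   its range is infinite. *)
have G0 n : G n !=set0.
  apply/set0P/eqP => Gn0; apply: nE; have [_ h] := fG n.
  have A0 : A set0 by exact: (@measurable0 _ (completed_type nu)).
  by rewrite -(setD0 E); apply/null_sets_completionE/h => //; rewrite Gn0.
exists (range G); split => [|_ [n _ <-]//]; split.
- move=> fD; apply: infinite_nat.
  apply: sub_finite_set (finite_preimage _ fD) => [n _|]; first by exists n.
  move=> i j _ _ Gij; have [x Gx] := G0 i.
  by apply: (uG _ _ x) => //; rewrite -Gij.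
- by move=> _ _ [i _ <-] [j _ <-] [x [Gi Gj]]; rewrite (uG _ _ _ Gi Gj).
- apply/seteqP; split => [x [_ [n _ <-] /GE]//|x Ex].
  have [[k _ Fx]|nFx] := pselect ((\bigcup_k F k.+1) x).
    by exists (G k.+1) => //; exists k.+1.
  by exists (G 0%N) => //; exists 0%N.
Qed.

(** At each stage [P] of the current remainder is cut off and the rest is kept. The remainders
    decrease, so the pieces are disjoint; fullness in [E] passes along by transitivity. *)
Lemma iterated_splitting E (P : set T -> set T) :
  (forall Q, full_subset A J Q (P Q)) ->
  (forall Q, full_subset A J Q (Q `\` P Q)) ->
  exists2 F : (set T)^nat,
    forall n, full_subset A J E (F n) & trivIset setT F.
Proof.
move=> fP fC; have PQ Q : P Q `<=` Q by have [] := fP Q.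
pose Q n := iter n (fun Q => Q `\` P Q) E.
have fQ n : full_subset A J E (Q n).
  elim: n => [|n IH]; last exact: full_subset_trans IH (fC _).
  split => // B _ EB; apply/null_sets_completionE.
  by apply: negligibleS (negligible_set0 nu) => x [/EB].
exists (P \o Q); first by move=> n; exact: full_subset_trans (fQ n) (fP _).
have QS m k : Q (m + k)%N `<=` Q m.
  elim: k => [|k IH]; first by rewrite addn0.
  by rewrite addnS; apply: subset_trans IH; exact: subDsetl.
have disj i j x : (i < j)%N -> P (Q i) x -> P (Q j) x -> False.
  move=> ij Pix /PQ Qjx.
  by have [] : Q i.+1 x by apply: (QS _ (j - i.+1)%N); rewrite subnKC.
move=> i j _ _ [x [/= Pi Pj]].
by have [ij|ji|//] := ltngtP i j; [case: (disj i j x)|case: (disj j i x)].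
Qed.

Lemma infinite_full_decomposition E : sigma_finite [set: T] nu ->
  (forall Q, ~ nu.-negligible Q ->
     exists M, [/\ measurable M, splits nu Q M & nu M <> 0]) ->
  infinite_set E -> exists D : set (set T),
    infinite_decomposition E D /\ forall F, D F -> full_subset A J E F.
Proof.
move=> nu_sf locP Einf.
have [nE|nE] := pselect (nu.-negligible E).
  exists [set [set x] | x in E]; split; first exact: singleton_decomposition.
  by move=> _ [x Ex <-]; apply: negligible_full_subset => // y ->.
have /choice[P PP] : forall Q : set T, exists P,
    full_subset A J Q P /\ full_subset A J Q (Q `\` P).
  move=> Q; have [M [mM [P PQ [tP tQP]] nQM]] :=
    splitting_exhaustion nu_sf (fun Q' (_ : Q' `<=` Q) => locP Q').
  by exists P; split; apply: thick_full_subset nQM _ => //; exact: subDsetl.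
have [F fF tF] := iterated_splitting E (fun Q => (PP Q).1) (fun Q => (PP Q).2).
exact: full_sequence_decomposition fF tF.
Qed.

End completion_ideal.

Theorem corollary3p1 (R : realType) (X : ptopologicalType)
    (nu : {measure set (borel X) -> \bar R})
    (mu : {measure set (completed_type nu) -> \bar R})
    (X_second_countable : @second_countable X)
    (X_T1 : accessible_space X)
    (nu_regular : regular_measure nu)
    (nu_sigma_finite : sigma_finite [set: borel X] nu)
    (nu_points : forall x : X, nu [set x] = 0)
    (mu_completion : is_completion mu)
    (E : set X) (E_infinite : infinite_set E) :
  let A : set (set X) := @measurable _ (completed_type nu) in
  let J : set (set X) := null_sets mu in
  (exists D : set (set X),
     infinite_decomposition E D /\
     forall F : set X, D F ->
       [/\ full_subset A J E F,
           completely_nonmeasurable A J E F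
         & mu^*%mu F = mu^*%mu E]) /\
  (forall D : set (set X), infinite_decomposition E D ->
     (forall F : set X, D F -> full_subset A J E F) <->
     (forall F : set X, D F -> completely_nonmeasurable A J E F)).
Proof.
have nx (x : X) : nu.-negligible ([set x] : set (borel X)).
  have mx : measurable ([set x] : set (borel X)).
    rewrite -(setCK [set x]); apply: measurableC; apply: open_borel.
    by rewrite openC; exact: accessible_closed_set1.
  by exists [set x]; split; [exact: mx|exact: nu_points|exact: subset_refl].
move=> A J.
have nonmeas D := @full_subset_nonmeasurable _ _ (borel X) nu mu mu_completion E D.
split; last exact: nonmeas.
suff [D [DE fD]] : exists D : set (set X), infinite_decomposition E D /\
    forall F, D F -> full_subset A J E F.
  exists D; split => // F DF; split; first exact: fD.
  - exact: (nonmeas D DE).1.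
  - exact/mu_ext_full_subset/fD.
apply: (@infinite_full_decomposition _ _ (borel X) nu mu) => // Q.
exact: locally_splits.
Qed.
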